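(* Let $\{Y_i\}_{i\ge1}$ be a sequence of $\mathbb{R}_+^J$-valued random vectors. Suppose each $Y_i$ admits two representations $$Y_i^\top = a_i\,W_i^\top H D_b=\tilde a_i\,\widetilde W_i^\top\widetilde H D_{\tilde b},$$ where $H,\widetilde H\in\mathbb{R}_+^{K\times J}$ are fixed and at least one of them has full row rank; the processes $\{W_i\}_{i\ge1}$ and $\{\widetilde W_i\}_{i\ge1}$ on $\mathbb{R}_+^K$ each satisfy Assumption E (ergodicity and stationarity) and Assumption S (probabilistic separability); and $D_b=\mathrm{diag}(b_1,\dots,b_J)$, $D_{\tilde b}=\mathrm{diag}(\tilde b_1,\dots,\tilde b_J)$ have (fixed) strictly positive diagonal entries. Assume that $\{a_i\}_{i\ge1}$ is a stationary and ergodic process with positive values and $\mathbb{E}(a_i)=1$, independent of $\{W_i\}_{i\ge1}$ (and of $\{b_j\}_{j=1}^J$), and analogously that $\{\tilde a_i\}_{i\ge1}$ is a stationary and ergodic process with positive values and $\mathbb{E}(\tilde a_i)=1$, independent of $\{\widetilde W_i\}_{i\ge1}$ (and of $\{\tilde b_j\}_{j=1}^J$). Define $W_i'=a_iW_i$, $H'=HD_b$, $\widetilde W_i'=\tilde a_i\widetilde W_i$, $\widetilde H'=\widetilde H D_{\tilde b}$. Let $\Phi'$ be the source attribution matrix derived from the marginal distribution $\mathbb{P}_{W'}$ of $W'_i$ and $H'$, and let $\widetilde\Phi'$ be the one derived from the marginal distribution $\mathbb{P}_{\widetilde W'}$ of $\widetilde W_i'$ and $\widetilde H'$. Then $\Phi'=\widetilde\Phi'$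 up to a permutation of rows. Moreover, $\Phi'=\Phi$, where $\Phi$ is the source attribution matrix derived from the marginal distribution $\mathbb{P}_W$ of $W_i$ and $H$.
   Context: $\mathbb{R}_+=[0,\infty)$. All random objects live on a common probability space. The scalings $b_j,\tilde b_j$ are treated as fixed positive constants (so independence from them is automatic). Assumption E (ergodicity and stationarity) for a process $\{W_i\}_{i\ge1}$: it is a (strictly) stationary ergodic process on $\mathbb{R}_+^K$ with marginal distribution $\mathbb{P}_W$ having support $\mathbb{S}_W\subseteq\mathbb{R}_+^K$ (a point $a$ belongs to $\mathbb S_W$ if and only if every open ball around $a$ has positive $\mathbb{P}_W$-probability), and with finite mean $\mu=\mathbb{E}(W_i)\in\mathbb{R}_+^K$. No independence across $i$ is assumed. Assumption S (probabilistic separability) for $\{W_i\}_{i\ge1}$: there exist constants $c_k>0$ such that $c_k e_k\in\mathbb{S}_W$ for every $k=1,\dots,K$, where $e_k$ is the $k$th canonical basis vector of $\mathbb{R}^K$. (The constants may differ between the processes.) Source attribution matrix: given a distribution on $\mathbb{R}_+^K$ with mean $\mu=(\mu_1,\dots,\mu_K)$ and a non-negative $K\times J$ matrix $H=(H_{kj})$, it is the $K\times J$ matrix $\Phi=(\phi_{kj})$ with $$\phi_{kj}=\frac{\mu_kH_{kj}}{\sum_{\ell=1}^K\mu_\ell H_{\ell j}} .$$ This definition presupposes that each denominator is positive (i.e. no pollutant column is identically zero). *)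

(* Defs.v *)
From HB Require Import structures.
From mathcomp Require Import all_boot all_order all_algebra all_fingroup.
From mathcomp Require Import all_classical all_reals all_analysis.

Set Implicit Arguments.
Unset Strict Implicit.
Unset Printing Implicit Defensive.

Import Order.TTheory GRing.Theory Num.Theory.
Import numFieldNormedType.Exports.

Local Open Scope classical_set_scope.
Local Open Scope ring_scope.

(* The Borel sigma-algebra of R^(m x n), presented as the product of the Borel
   sigma-algebras of the entries. *)
Fact borel_mx_display : measure_display.
Proof. exact: default_measure_display. Qed.

Section borel_mx.
Variables (R : realType) (m n : nat).

Definition mx_cylinder : set (set 'M[R]_(m, n)) :=
  \bigcup_(ij in [set: 'I_m * 'I_n])
    preimage_set_system setT (fun M : 'M[R]_(m, n) => M ij.1 ij.2) measurable.

HB.instance Definition _ := @isMeasurable.Build borel_mx_display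
  'M[R]_(m, n) <<s mx_cylinder >> (@sigma_algebra0 _ setT mx_cylinder)
  (@sigma_algebraC _ mx_cylinder) (@sigma_algebra_bigcup _ setT mx_cylinder).

Lemma measurable_mx_entry i j :
  measurable_fun [set: 'M[R]_(m, n)] (fun M : 'M[R]_(m, n) => M i j).
Proof.
by move=> _ A mA; apply: sub_sigma_algebra; exists (i, j) => //; exists A.
Qed.

Lemma measurable_fun_mxP d (T : measurableType d) (f : T -> 'M[R]_(m, n)) :
  (forall i j, measurable_fun setT (fun t => f t i j)) -> measurable_fun setT f.
Proof.
move=> mf; apply: (@measurability _ _ _ _ _ _ mx_cylinder) => //.
move=> _ [_ [[i j] _ [A mA <-]] <-].
rewrite !setTI -[X in measurable X]setTI; exact: (mf i j measurableT A mA).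
Qed.

End borel_mx.

Section processes.
Variables (d : measure_display) (T : measurableType d) (R : realType).
Variable P : probability T R.

(* The product sigma-algebra on the space of sequences (paths) in S. *)
Definition measurable_path d' (S : measurableType d') : set (set (nat -> S)) :=
  <<s \bigcup_i preimage_set_system setT (fun x : nat -> S => x i) measurable >>.

Definition path_event d' (S : measurableType d')
    (X : nat -> {RV P >-> S}) (A : set (nat -> S)) : set T :=
  [set t | A (fun i => X i t)].

Definition stationary d' (S : measurableType d') (X : nat -> {RV P >-> S}) :=
  forall (h : nat) (A : set (nat -> S)), measurable_path A ->
    P (path_event (fun i => X (h + i)%N) A) = P (path_event X A).

Definition ergodic d' (S : measurableType d') (X : nat -> {RV P >-> S}) :=
  forall A : set (nat -> S), measurable_path A ->
    (fun x : nat -> S => fun i => x i.+1) @^-1` A = A ->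
    P (path_event X A) = 0%E \/ P (path_event X A) = 1%E.

Definition independent_processes d1 (S1 : measurableType d1)
    d2 (S2 : measurableType d2)
    (X : nat -> {RV P >-> S1}) (Z : nat -> {RV P >-> S2}) :=
  forall (A : set (nat -> S1)) (B : set (nat -> S2)),
    measurable_path A -> measurable_path B ->
    P (path_event X A `&` path_event Z B) =
    (P (path_event X A) * P (path_event Z B))%E.

(* Balls of 'rV[R]_K are sup-norm balls; they define the same support as
   Euclidean ones. *)
Definition support K (mu : probability 'rV[R]_K R) : set 'rV[R]_K :=
  [set a | forall e : R, 0 < e -> (0 < mu (ball a e))%E].

(* The law of the first variable is that of every variable when the process is
   stationary. *)
Definition marginal K (W : nat -> {RV P >-> 'rV[R]_K}) : probability 'rV[R]_K R :=
  distribution P (W 0%N).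

Definition ergodic_stationary K (W : nat -> {RV P >-> 'rV[R]_K}) :=
  [/\ forall i t k, 0 <= W i t 0 k,
      stationary W,
      ergodic W &
      forall i k, P.-integrable setT (fun t => (W i t 0 k)%:E)].

Definition prob_separable K (W : nat -> {RV P >-> 'rV[R]_K}) :=
  exists c : 'I_K -> R, forall k,
    0 < c k /\ support (marginal W) (c k *: delta_mx 0 k).

Section rescaled.
Variables (K : nat) (a : {RV P >-> R}) (W : {RV P >-> 'rV[R]_K}).

Definition rescaled (t : T) : 'rV[R]_K := a t *: W t.

Lemma measurable_rescaled : measurable_fun setT rescaled.
Proof.
apply: measurable_fun_mxP => i j.
rewrite (_ : (fun t => _) = (a : T -> R) \* (fun t => W t i j)); last first.
  by apply/funext => t; rewrite /rescaled mxE.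
apply: measurable_realfun.measurable_funM => //.
exact: (measurableT_comp (measurable_mx_entry i j)).
Qed.

HB.instance Definition _ :=
  @isMeasurableFun.Build _ _ _ _ rescaled measurable_rescaled.

Definition rescaled_RV : {RV P >-> 'rV[R]_K} := rescaled.

End rescaled.

End processes.

Section source_attribution.
Variables (R : realType) (K J : nat).

Definition mean (mu : probability 'rV[R]_K R) : 'rV[R]_K :=
  \row_k \int[mu]_x (x 0 k).

Definition source_attribution (mu : probability 'rV[R]_K R) (H : 'M[R]_(K, J)) :
    'M[R]_(K, J) :=
  \matrix_(k, j) (mean mu 0 k * H k j / \sum_l mean mu 0 l * H l j).

Definition nonneg_mx (H : 'M[R]_(K, J)) := forall k j, 0 <= H k j.

Definition no_zero_column (H : 'M[R]_(K, J)) := forall j, exists k, H k j != 0.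

End source_attribution.

(* Main.v *)
Require Import Defs.
From HB Require Import structures.
From mathcomp Require Import all_boot all_order all_algebra all_fingroup.
From mathcomp Require Import all_classical all_reals all_analysis.
From mathcomp Require Import measurable_realfun lra.

Set Implicit Arguments.
Unset Strict Implicit.
Unset Printing Implicit Defensive.

Import Order.TTheory GRing.Theory Num.Theory.
Import numFieldNormedType.Exports.

Local Open Scope classical_set_scope.
Local Open Scope ring_scope.

(** Write [M = H *m diag_mx b] and [tM = tH *m diag_mx tb] for the two rescaled
    profile matrices, and suppose that [M] is row free (the other case follows
    by exchanging the two representations and inverting the permutation).

    Identification is a statement about cones. The observed vector lies almost
    surely in the cone of the rows of [tM]. Separability says that the law of
    the sources charges every neighbourhood of a point on each coordinate axis,
    and those axis points are sent by [M] to positive multiples of its rows.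
    So every row of [M] lies in the closed cone of [tM], and by symmetry every
    row of [tM] lies in the closed cone of [M] ([support_in_cone_closure]).
    A finitely generated cone with independent generators is closed
    ([row_free_cone_closed]), so [tM = B *m M] and [M = A *m tM] with
    nonnegative [A] and [B], and cancelling [M] gives [A *m B = 1].
    A nonnegative matrix with a nonnegative inverse has exactly one nonzero
    entry in each row and column ([nonneg_inverse_monomial]): the two cones have
    the same extremal rays.

    Cancelling [M] in the equality of the two representations then shows that
    the rescaled sources are the same up to a permutation and positive factors,
    and these factors are the inverses of those relating the rows of [tM] to
    those of [M]. The mean contribution of a source to a column, mean times
    profile entry, is therefore the same for matching sources, and source
    attribution is the normalisation of these contributions
    ([source_attribution_perm]). The matching comes from [B] alone, so it is the
    same at every time.

    The last assertion is a moment computation: by independence the mean of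
    [a_i W_i] is the product of the means ([integral_indep_prod]), so it is that
    of [W_i], and the weights [b] cancel between numerator and denominator. *)

(** * Closed cones spanned by matrix rows *)

Section cones.
Variable R : realType.

(** Membership of [v] in the closure of the cone spanned by the rows of [M],
    in a form that directly takes the points provided by small balls. *)
Definition in_cone_closure m n (M : 'M[R]_(m, n)) (v : 'rV[R]_n) :=
  forall e : R, 0 < e ->
    exists2 x : 'rV[R]_m, nonneg_mx x & forall j, `|(x *m M - v) 0 j| < e.

(** Continuity at 0 of [u |-> u *m M] for the sup norm; it transports
    approximations through linear maps. *)
Lemma mulmx_small m n (M : 'M[R]_(m, n)) (e : R) : 0 < e ->
  exists2 r, 0 < r & forall u : 'rV[R]_m,
    (forall i, `|u 0 i| < r) -> forall j, `|(u *m M) 0 j| < e.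
Proof.
(* The summand 1 keeps the constant positive when [M = 0]. *)
move=> e0; pose C := 1 + \sum_i \sum_j `|M i j|.
have C0 : 0 < C by rewrite ltr_wpDr // sumr_ge0 // => i _; rewrite sumr_ge0.
have r0 : 0 < e / C by rewrite divr_gt0.
exists (e / C) => // u ur j; rewrite mxE.
apply: (@le_lt_trans _ _ (e / C * \sum_i `|M i j|)).
  apply: le_trans (ler_norm_sum _ _ _) _; rewrite mulr_sumr.
  by apply: ler_sum => i _; rewrite normrM ler_wpM2r // ltW.
rewrite -[ltRHS](divfK (lt0r_neq0 C0)) ltr_pM2l // ltr_pwDl //.
by apply: ler_sum => i _; rewrite (bigD1 j) //= lerDl sumr_ge0.
Qed.

Lemma in_cone_closureM m n p (M : 'M[R]_(m, n)) (N : 'M[R]_(n, p)) v :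
  in_cone_closure M v -> in_cone_closure (M *m N) (v *m N).
Proof.
move=> Mv e /(mulmx_small N)[r r0 rN]; have [x x0 xr] := Mv r r0.
by exists x => // j; rewrite mulmxA -mulmxBl; exact: rN.
Qed.

Lemma in_cone_closureZ m n (M : 'M[R]_(m, n)) v c :
  0 < c -> in_cone_closure M (c *: v) -> in_cone_closure M v.
Proof.
move=> c0 Mv e e0; have [x x0 xr] := Mv (c * e) (mulr_gt0 c0 e0).
exists (c^-1 *: x) => [i j|j].
  by rewrite mxE mulr_ge0 // invr_ge0 ltW.
rewrite -(ltr_pM2l c0) -[X in X * `|_|](gtr0_norm c0) -normrM.
have -> : c * (c^-1 *: x *m M - v) 0 j = (x *m M - c *: v) 0 j.
  rewrite -scalemxAl !mxE mulrBr mulrA divff ?mul1r ?gt_eqF //.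
exact: xr.
Qed.

Lemma in_cone_closure1 n (v : 'rV[R]_n) :
  in_cone_closure 1%:M v -> nonneg_mx v.
Proof.
move=> v1 k j; rewrite ord1; apply/ler_addgt0Pr => e e0.
have [x x0 xv] := v1 e e0; have := xv j; rewrite mulmx1 !mxE ltr_norml.
move=> /andP[_ xve]; rewrite addrC -lerBlDr sub0r.
by have := x0 0 j; have := ltW xve; lra.
Qed.

(** A row space is closed: [cokermx M] sends the whole cone to 0, hence also its
    limit points. *)
Lemma in_cone_closure_submx m n (M : 'M[R]_(m, n)) v :
  in_cone_closure M v -> (v <= M)%MS.
Proof.
move=> /(in_cone_closureM (cokermx M)); rewrite mulmx_coker => v0.
rewrite submxE; apply/eqP/rowP => j; rewrite [RHS]mxE; apply/eqP.
rewrite -normr_le0; apply/ler_addgt0Pr => e e0; rewrite add0r.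
have [x _ /(_ j)] := v0 e e0.
by rewrite mulmx0 sub0r !mxE normrN => /ltW.
Qed.

(** For independent rows, multiplication by [pinvmx M] is a continuous
    coordinate map: it turns the cone into the nonnegative orthant, which is
    closed. So limits of nonnegative combinations are nonnegative combinations. *)
Lemma row_free_cone_closed m n p (M : 'M[R]_(m, n)) (N : 'M[R]_(p, n)) :
    row_free M -> (forall k, in_cone_closure M (row k N)) ->
  exists2 B : 'M[R]_(p, m), nonneg_mx B & N = B *m M.
Proof.
move=> Mfree MN; exists (N *m pinvmx M) => [k l|].
  have := in_cone_closureM (pinvmx M) (MN k).
  by rewrite mulmxVp // => /in_cone_closure1/(_ 0 l); rewrite -row_mul mxE.
rewrite mulmxKpV //; apply/row_subP => k; exact: in_cone_closure_submx.
Qed.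

(** The off-diagonal entries of [A *m B] and [B *m A] are sums of nonnegative
    terms, so all these terms vanish. A diagonal entry of [B *m A] is 1, so each
    row [k] of [B] meets a column [l] with [A l k] and [B k l] nonzero. The
    vanishing terms then force [B k m = 0] for [m != l], and make the choice
    of [l] injective in [k]. *)
Lemma nonneg_inverse_monomial n (A B : 'M[R]_n) :
    nonneg_mx A -> nonneg_mx B -> A *m B = 1%:M ->
  exists s : 'S_n, forall k l, l != s k -> B k l = 0.
Proof.
move=> A0 B0 AB1; have BA1 := mulmx1C AB1.
have AB0 l k m : l != m -> A l k * B k m = 0.
  move=> lm; have := congr1 (fun M : 'M[R]_n => M l m) AB1; rewrite !mxE (negbTE lm).
  by move/psumr_eq0P; apply => // i _; rewrite mulr_ge0.
have BA0 k l m : k != m -> B k l * A l m = 0.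
  move=> lm; have := congr1 (fun M : 'M[R]_n => M k m) BA1; rewrite !mxE (negbTE lm).
  by move/psumr_eq0P; apply => // i _; rewrite mulr_ge0.
have BA k : exists l, B k l * A l k != 0.
  apply/existsP; apply: contraT; rewrite negb_exists => /forallP BAk0.
  have := congr1 (fun M : 'M[R]_n => M k k) BA1; rewrite !mxE eqxx big1.
    by move=> /esym/eqP; rewrite oner_eq0.
  by move=> l _; apply/eqP; have := BAk0 l; rewrite negbK.
pose f k := sval (cid (BA k)).
have fP k : B k (f k) * A (f k) k != 0 by exact: svalP (cid (BA k)).
have finj : injective f.
  move=> k k' fkk'; apply/eqP; apply: contraT => /(BA0 _ (f k)) /eqP.
  rewrite mulf_eq0 {2}fkk'; have := fP k; have := fP k'.
  by rewrite !mulf_eq0 !negb_or => /andP[_ /negbTE ->] /andP[/negbTE ->].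
exists (perm finj) => k l; rewrite permE => lf.
have /eqP : A (f k) k * B k l = 0 by apply: AB0; rewrite eq_sym.
have := fP k; rewrite !mulf_eq0 negb_or => /andP[_ /negbTE -> /=].
by move/eqP.
Qed.

End cones.

Section random_vectors.
Context d (T : measurableType d) (R : realType).
Variable P : probability T R.

(** * Means of rescaled sources *)

Lemma mean_distribution K (X : {RV P >-> 'rV[R]_K}) k :
  P.-integrable setT (fun t => (X t 0 k)%:E) ->
  mean (distribution P X) 0 k = \int[P]_t (X t 0 k).
Proof.
move=> intX; rewrite mxE /Rintegral integral_distribution //.
by apply/measurable_EFinP; exact: measurable_mx_entry.
Qed.

(** Independence says that the joint law of [X] and [Z] agrees with the product
    of their laws on rectangles, hence everywhere; the integral of the product
    is then computed by Tonelli. *)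
Lemma integral_indep_prod d1 (T1 : measurableType d1) d2
    (T2 : measurableType d2) (X : {RV P >-> T1}) (Z : {RV P >-> T2})
    (f : T1 -> R) (g : T2 -> R) :
    (forall A B, measurable A -> measurable B ->
       P (X @^-1` A `&` Z @^-1` B) = P (X @^-1` A) * P (Z @^-1` B))%E ->
    measurable_fun setT f -> measurable_fun setT g ->
    (forall x, 0 <= f x) -> (forall z, 0 <= g z) ->
  (\int[P]_t (f (X t) * g (Z t))%:E =
   (\int[P]_t (f (X t))%:E) * (\int[P]_t (g (Z t))%:E))%E.
Proof.
move=> XZ mf mg f0 g0.
have mXZ : measurable_fun setT (fun t => (X t, Z t)).
  exact: measurable_fun_pair.
pose XZ_mfun := isMeasurableFun.Build _ _ _ _ _ mXZ.
pose XZ_RV : {RV P >-> (T1 * T2)%type} := HB.pack (fun t => (X t, Z t)) XZ_mfun.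
pose h (z : T1 * T2) := (f z.1 * g z.2)%:E.
have mh : measurable_fun setT h.
  apply/measurable_EFinP; apply: measurable_funM.
    exact: (measurableT_comp mf).
  exact: (measurableT_comp mg).
have h_ge0 z : (0 <= h z)%E by rewrite lee_fin mulr_ge0.
have mEf : measurable_fun setT (EFin \o f) by exact/measurable_EFinP.
have mEg : measurable_fun setT (EFin \o g) by exact/measurable_EFinP.
transitivity (\int[distribution P XZ_RV]_z h z)%E.
  by rewrite ge0_integral_distribution.
transitivity (\int[(distribution P X \x distribution P Z)%E]_z h z)%E.
  apply: eq_measure_integral => A mA _; apply/esym.
  exact: product_measure_unique.
rewrite fubini_tonelli1 // /fubini_F.
transitivity (\int[distribution P X]_x
    ((f x)%:E * \int[P]_t (g (Z t))%:E))%E.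
  apply: eq_integral => x _; rewrite /h /=.
  under eq_integral do rewrite EFinM.
  rewrite ge0_integralZl ?lee_fin //; last by move=> z _; rewrite lee_fin.
  by rewrite ge0_integral_distribution // => z; rewrite /= lee_fin.
rewrite ge0_integralZr //.
- by rewrite ge0_integral_distribution // => z; rewrite /= lee_fin.
- by move=> x _; rewrite lee_fin.
- by apply: integral_ge0 => t _; rewrite lee_fin.
Qed.

Lemma integral_rescaled K (a : {RV P >-> R}) (W : {RV P >-> 'rV[R]_K}) k :
    (forall A B, measurable A -> measurable B ->
       P (a @^-1` A `&` W @^-1` B) = P (a @^-1` A) * P (W @^-1` B))%E ->
    (forall t, 0 < a t) -> (forall t k, 0 <= W t 0 k) ->
  (\int[P]_t (rescaled a W t 0 k)%:E =
   (\int[P]_t (a t)%:E) * \int[P]_t (W t 0 k)%:E)%E.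
Proof.
move=> aW a0 W0.
(* Norms make both factors nonnegative on the whole space of values, as the
   product rule requires; entries are only known to be nonnegative on the
   range of [W]. *)
transitivity (\int[P]_t (`|a t| * `|W t 0 k|)%:E)%E.
  apply: eq_integral => t _; rewrite mxE !ger0_norm //.
  exact: ltW.
rewrite (@integral_indep_prod _ _ _ _ a W Num.norm
  (fun M => `|M 0 k|)) //; last first.
  by apply: measurableT_comp => //; exact: measurable_mx_entry.
congr (_ * _)%E; apply: eq_integral => t _; rewrite ger0_norm //.
exact: ltW.
Qed.

(** Events on one coordinate are measurable path events. *)
Lemma independent_processes_RV d1 (S1 : measurableType d1) d2
    (S2 : measurableType d2)
    (X : nat -> {RV P >-> S1}) (Z : nat -> {RV P >-> S2}) i :
    independent_processes X Z -> forall A B, measurable A -> measurable B ->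
  P (X i @^-1` A `&` Z i @^-1` B) = (P (X i @^-1` A) * P (Z i @^-1` B))%E.
Proof.
move=> XZ A B mA mB; apply: (XZ [set x | A (x i)] [set x | B (x i)]).
  by apply: sub_sigma_algebra; exists i => //; exists A => //; rewrite setTI.
by apply: sub_sigma_algebra; exists i => //; exists B => //; rewrite setTI.
Qed.

Section rescaled_mean.
Variables (K : nat) (a : nat -> {RV P >-> R}) (W : nat -> {RV P >-> 'rV[R]_K}).
Hypotheses (a_gt0 : forall i t, 0 < a i t).
Hypotheses (WE : ergodic_stationary W) (aW : independent_processes a W).
Hypothesis a_mean : forall i, ('E_P[a i] = 1)%E.

Lemma rescaled_moment i k :
  (\int[P]_t (rescaled_RV (a i) (W i) t 0 k)%:E = \int[P]_t (W i t 0 k)%:E)%E.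
Proof.
have [W0 _ _ _] := WE.
rewrite (@integral_rescaled _ (a i) (W i)) //; last first.
  exact: independent_processes_RV.
by have := a_mean i; rewrite unlock => ->; rewrite mul1e.
Qed.

Lemma rescaled_integrable i k :
  P.-integrable setT (fun t => (rescaled_RV (a i) (W i) t 0 k)%:E).
Proof.
have [W0 _ _ /(_ i k)/integrableP[_ Wfin]] := WE.
apply/integrableP; split.
  by apply/measurable_EFinP/(measurableT_comp (measurable_mx_entry 0 k)).
under eq_integral.
  move=> t _; rewrite gee0_abs; last by rewrite lee_fin mxE mulr_ge0 // ltW.
  over.
rewrite rescaled_moment; under eq_integral do rewrite -[_%:E]gee0_abs ?lee_fin //.
exact: Wfin.
Qed.

Lemma rescaled_mean i :
  mean (distribution P (rescaled_RV (a i) (W i))) = mean (distribution P (W i)).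
Proof.
have [_ _ _ intW] := WE; apply/rowP => k.
rewrite !mean_distribution //; last exact: rescaled_integrable.
by rewrite /Rintegral rescaled_moment.
Qed.

End rescaled_mean.

(** * From supports to cones *)

Lemma measurable_row_ball K (v : 'rV[R]_K) (e : R) :
  0 < e -> measurable (ball v e).
Proof.
move=> e0; rewrite (_ : ball v e =
    \bigcap_(k in [set: 'I_K]) (fun M : 'rV[R]_K => M 0 k) @^-1` ball (v 0 k) e).
  apply: fin_bigcap_measurable => // k _; rewrite -[X in measurable X]setTI.
  by apply: measurable_mx_entry => //; exact: measurable_ball.
apply/seteqP; split=> [x [_ vx] k _|x vx]; first exact: vx.
by split=> // i k; rewrite ord1; exact: vx.
Qed.

(** A ball around a support point [v] has positive probability, so it contains
    a value of [W] at an outcome where the two representations agree. Dividing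
    by [a t] exhibits a point of the cone of [N] close to [v *m M]. *)
Lemma support_in_cone_closure K J (a ta : T -> R) (W : {RV P >-> 'rV[R]_K})
    (tW : T -> 'rV[R]_K) (M N : 'M[R]_(K, J)) (v : 'rV[R]_K) :
    (forall t, 0 < a t) -> (forall t, 0 < ta t) -> (forall t, nonneg_mx (tW t)) ->
    {ae P, forall t, a t *: (W t *m M) = ta t *: (tW t *m N)} ->
    Defs.support (distribution P W) v ->
  in_cone_closure N (v *m M).
Proof.
move=> a0 ta0 tW0 MN vW e /(mulmx_small M)[r r0 rM].
have [t [[_ Wt] eqt]] : exists t, ball v r (W t) /\
    a t *: (W t *m M) = ta t *: (tW t *m N).
  apply: contrapT => nex; have := vW r r0.
  have [N0 [mN0 PN0 subN0]] := MN.
  rewrite ltNge => /negP; apply.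
  rewrite -PN0; apply: (@le_measure _ _ _ P).
  - rewrite inE -[X in measurable X]setTI.
    by apply: measurable_funPT => //; exact: measurable_row_ball.
  - by rewrite inE.
  - by move=> t Wt; apply: subN0 => /= eqt; apply: nex; exists t.
exists ((a t)^-1 * ta t *: tW t) => [i j|j].
  by rewrite mxE; apply: mulr_ge0; [rewrite mulr_ge0 ?invr_ge0 ?ltW|exact: tW0].
rewrite -scalemxAl -scalerA -eqt scalerA mulVf ?gt_eqF // scale1r -mulmxBl.
apply: rM => i; rewrite !mxE distrC; exact: Wt.
Qed.

(** Each row of [H] is, up to a positive factor, the image of a support point
    of the law of [W], so it lies in the closed cone of [tH], and conversely.
    Since [H] is row free, [tH = B *m H] with [B >= 0]; the inclusion of row
    spaces makes [tH] row free too, so [H = A *m tH] with [A >= 0]. Cancelling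
    [H] in [A *m B *m H = H] shows that [A] inverts [B]. *)
Lemma representation_change K J (a ta : T -> R)
    (W tW : {RV P >-> 'rV[R]_K}) (H tH : 'M[R]_(K, J)) :
    (forall t, 0 < a t) -> (forall t, 0 < ta t) ->
    (forall t, nonneg_mx (W t)) -> (forall t, nonneg_mx (tW t)) ->
    {ae P, forall t, a t *: (W t *m H) = ta t *: (tW t *m tH)} ->
    (exists c : 'I_K -> R, forall k,
      0 < c k /\ Defs.support (distribution P W) (c k *: delta_mx 0 k)) ->
    (exists c : 'I_K -> R, forall k,
      0 < c k /\ Defs.support (distribution P tW) (c k *: delta_mx 0 k)) ->
    row_free H ->
  exists2 B : 'M[R]_K, tH = B *m H &
    exists s : 'S_K, forall k l, l != s k -> B k l = 0.
Proof.
move=> a0 ta0 W0 tW0 WtW [c cW] [tc ctW] Hfree.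
have HtH k : in_cone_closure tH (row k H).
  have [ck cksupp] := cW k; apply: (in_cone_closureZ ck).
  rewrite rowE scalemxAl; exact: (support_in_cone_closure a0 ta0 tW0 WtW cksupp).
have tHH k : in_cone_closure H (row k tH).
  have [ck cksupp] := ctW k; apply: (in_cone_closureZ ck).
  rewrite rowE scalemxAl; apply: (support_in_cone_closure ta0 a0 W0) cksupp.
  by apply: filterS WtW => t ->.
have tHfree : row_free tH.
  have leH : (H <= tH)%MS.
    by apply/row_subP => k; exact: in_cone_closure_submx.
  rewrite /row_free eqn_leq rank_leq_row -{1}(eqP Hfree); exact: mxrankS.
have [B B0 tHB] := row_free_cone_closed Hfree tHH.
have [A A0 HA] := row_free_cone_closed tHfree HtH.
exists B => //; apply: (nonneg_inverse_monomial A0 B0).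
by apply: (row_free_inj Hfree); rewrite mul1mx -mulmxA -tHB -HA.
Qed.

(** * Matching of source attributions *)

(** The factor [b 0 j] is common to the numerator and to the denominator. *)
Lemma source_attribution_scale K J (mu nu : probability 'rV[R]_K R)
    (H : 'M[R]_(K, J)) (b : 'rV[R]_J) :
    (forall j, 0 < b 0 j) -> mean mu = mean nu ->
  source_attribution mu (H *m diag_mx b) = source_attribution nu H.
Proof.
move=> b0 munu; apply/matrixP => k j; rewrite [LHS]mxE [RHS]mxE munu.
have HbE l : (H *m diag_mx b) l j = H l j * b 0 j by rewrite mul_mx_diag mxE.
rewrite HbE mulrA; under eq_bigr => l _ do rewrite HbE mulrA.
by rewrite -mulr_suml -mulf_div divff ?mulr1 ?gt_eqF.
Qed.

(** Source attribution only sees the mean contributions [mean mu 0 k * H k j];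
    its denominators are the column sums of these, which do not depend on the
    order of the rows. *)
Lemma source_attribution_perm K J (mu nu : probability 'rV[R]_K R)
    (H G : 'M[R]_(K, J)) (s : 'S_K) :
    (forall k j, mean nu 0 k * G k j = mean mu 0 (s k) * H (s k) j) ->
  source_attribution nu G = row_perm s (source_attribution mu H).
Proof.
move=> eqHG; apply/matrixP => k j; rewrite [LHS]mxE [RHS]mxE [RHS]mxE [in LHS]eqHG.
congr (_ / _); rewrite [RHS](reindex_inj (@perm_inj _ s)).
by apply: eq_bigr => l _; exact: eqHG.
Qed.

(** Cancelling [H] gives [X = tX *m B] almost surely, and the only entry of
    column [s k] of the monomial matrix [B] lies in row [k]. *)
Lemma monomial_mean K J (X tX : {RV P >-> 'rV[R]_K}) (H : 'M[R]_(K, J))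
    (B : 'M[R]_K) (s : 'S_K) :
    row_free H -> (forall k l, l != s k -> B k l = 0) ->
    {ae P, forall t, X t *m H = tX t *m (B *m H)} ->
    (forall k, P.-integrable setT (fun t => (X t 0 k)%:E)) ->
    (forall k, P.-integrable setT (fun t => (tX t 0 k)%:E)) ->
  forall k, mean (distribution P X) 0 (s k) =
            mean (distribution P tX) 0 k * B k (s k).
Proof.
move=> Hfree Bs XtX intX inttX k.
rewrite !mean_distribution // -RintegralZr //; last exact: inttX.
rewrite /Rintegral; congr fine.
have mentry (Z : {RV P >-> 'rV[R]_K}) l : measurable_fun setT (fun t => Z t 0 l).
  exact: (measurableT_comp (measurable_mx_entry 0 l)).
apply: ae_eq_integral => //.
- exact/measurable_EFinP.
- by apply/measurable_EFinP; exact: measurable_funM.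
apply: filterS XtX => t; rewrite mulmxA => /(row_free_inj Hfree) -> _.
rewrite mxE (bigD1 k) //= big1 ?addr0 // => l lk.
by rewrite Bs ?mulr0 // (inj_eq perm_inj) eq_sym.
Qed.

(** The matching [s] is extracted at time 0, where the supports are given; the
    almost sure equalities transfer it to every other time. *)
Lemma source_attribution_unique K J (a ta : nat -> {RV P >-> R})
    (W tW : nat -> {RV P >-> 'rV[R]_K}) (M tM : 'M[R]_(K, J)) :
    (forall i t, 0 < a i t) -> (forall i t, 0 < ta i t) ->
    (forall i t, nonneg_mx (W i t)) -> (forall i t, nonneg_mx (tW i t)) ->
    (forall i k,
       P.-integrable setT (fun t => (rescaled_RV (a i) (W i) t 0 k)%:E)) ->
    (forall i k,
       P.-integrable setT (fun t => (rescaled_RV (ta i) (tW i) t 0 k)%:E)) ->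
    (forall i,
       {ae P, forall t, a i t *: (W i t *m M) = ta i t *: (tW i t *m tM)}) ->
    prob_separable W -> prob_separable tW -> row_free M ->
  exists s : 'S_K, forall i,
    source_attribution (distribution P (rescaled_RV (ta i) (tW i))) tM =
    row_perm s (source_attribution (distribution P (rescaled_RV (a i) (W i))) M).
Proof.
move=> a0 ta0 W0 tW0 intW inttW WtW WS tWS Mfree.
have [B tMB [s Bs]] := representation_change (a0 0%N) (ta0 0%N) (W0 0%N)
  (tW0 0%N) (WtW 0%N) WS tWS Mfree.
exists s => i; apply: source_attribution_perm => k j.
rewrite (monomial_mean Mfree Bs _ (intW i) (inttW i)); last first.
  apply: filterS (WtW i) => t; rewrite !scalemxAl -tMB; exact.
rewrite -mulrA; congr (_ * _); rewrite tMB mxE (bigD1 (s k)) //= big1 ?addr0 //.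
by move=> l lk; rewrite Bs // mul0r.
Qed.

End random_vectors.

Theorem corollary1 (d : measure_display) (T : measurableType d) (R : realType)
    (P : probability T R) (K J : nat)
    (Y : nat -> {RV P >-> 'rV[R]_J})
    (W tW : nat -> {RV P >-> 'rV[R]_K}) (a ta : nat -> {RV P >-> R})
    (H tH : 'M[R]_(K, J)) (b tb : 'rV[R]_J)
    (Y_ge0 : forall i t j, 0 <= Y i t 0 j)
    (YE : forall i, {ae P, forall t, Y i t = a i t *: (W i t *m H *m diag_mx b)})
    (tYE : forall i,
       {ae P, forall t, Y i t = ta i t *: (tW i t *m tH *m diag_mx tb)})
    (H_ge0 : nonneg_mx H) (tH_ge0 : nonneg_mx tH)
    (H_col : no_zero_column H) (tH_col : no_zero_column tH)
    (H_rank : row_free H \/ row_free tH)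
    (WE : ergodic_stationary W) (WS : prob_separable W)
    (tWE : ergodic_stationary tW) (tWS : prob_separable tW)
    (b_gt0 : forall j, 0 < b 0 j) (tb_gt0 : forall j, 0 < tb 0 j)
    (a_gt0 : forall i t, 0 < a i t)
    (a_stat : stationary a) (a_erg : ergodic a)
    (a_mean : forall i, ('E_P[a i] = 1)%E)
    (a_W : independent_processes a W)
    (ta_gt0 : forall i t, 0 < ta i t)
    (ta_stat : stationary ta) (ta_erg : ergodic ta)
    (ta_mean : forall i, ('E_P[ta i] = 1)%E)
    (ta_tW : independent_processes ta tW) :
  let W' i := rescaled_RV (a i) (W i) in
  let tW' i := rescaled_RV (ta i) (tW i) in
  let H' := H *m diag_mx b in
  let tH' := tH *m diag_mx tb in
  let Phi i := source_attribution (distribution P (W i)) H in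
  let Phi' i := source_attribution (distribution P (W' i)) H' in
  let tPhi' i := source_attribution (distribution P (tW' i)) tH' in
  (exists s : 'S_K, forall i, Phi' i = row_perm s (tPhi' i)) /\
  (forall i, Phi' i = Phi i).
Proof.
move=> W' tW' H' tH' Phi Phi' tPhi'.
have [W0 _ _ _] := WE; have [tW0 _ _ _] := tWE.
have W0' i t : nonneg_mx (W i t) by move=> k j; rewrite ord1.
have tW0' i t : nonneg_mx (tW i t) by move=> k j; rewrite ord1.
have intW' := rescaled_integrable a_gt0 WE a_W a_mean.
have inttW' := rescaled_integrable ta_gt0 tWE ta_tW ta_mean.
have WtW i : {ae P, forall t, a i t *: (W i t *m H') = ta i t *: (tW i t *m tH')}.
  by apply: filterS2 (YE i) (tYE i) => t; rewrite -!mulmxA => <-.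
have tWW i : {ae P, forall t, ta i t *: (tW i t *m tH') = a i t *: (W i t *m H')}.
  by apply: filterS (WtW i) => t ->.
have free_scale (G : 'M[R]_(K, J)) (c : 'rV[R]_J) :
    (forall j, 0 < c 0 j) -> row_free G -> row_free (G *m diag_mx c).
  move=> c0 Gfree; rewrite /row_free mxrankMfree //.
  rewrite row_free_unit unitmxE det_diag unitfE; apply/prodf_neq0 => j _.
  by rewrite gt_eqF.
split=> [|i]; last first.
  exact: (source_attribution_scale _ b_gt0 (rescaled_mean a_gt0 WE a_W a_mean i)).
case: H_rank => [/(free_scale _ _ b_gt0) Hfree|/(free_scale _ _ tb_gt0) tHfree].
  have [s sP] := source_attribution_unique a_gt0 ta_gt0 W0' tW0' intW' inttW'
    WtW WS tWS Hfree.
  exists s^-1%g => i; rewrite /Phi' /tPhi' sP -row_permM mulVg row_perm1 //.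
have [s sP] := source_attribution_unique ta_gt0 a_gt0 tW0' W0' inttW' intW'
  tWW tWS WS tHfree.
by exists s.
Qed.
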